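(* Let $p,q$ be distinct prime numbers with $p>q$. Up to isomorphism, a complete list of the commutative non-degenerate solutions of size $pq$ on a left-zero semigroup is the following: (1) the solution $(\mathbb{Z}/pq\mathbb{Z},s)$ given by $s(x,y)=(x,y)$; (2) the solution $(\mathbb{Z}/pq\mathbb{Z},s)$ given by $s(x,y)=(x,-x+y)$; (3) if $p-1\equiv 0 \pmod q$, the solution $(\mathbb{Z}/p\mathbb{Z}\rtimes\mathbb{Z}/q\mathbb{Z},s)$ given by $s(x,y)=(x,x^{-1}\circ y)$, where $\mathbb{Z}/p\mathbb{Z}\rtimes\mathbb{Z}/q\mathbb{Z}$ is the non-abelian semidirect product and $\circ$ is its group operation; (4) the unique (up to isomorphism) commutative non-degenerate solution on a left-zero semigroup with cyclic associated permutation group having $p$ orbits of $q$ elements each; (5) the unique (up to isomorphism) commutative non-degenerate solution on a left-zero semigroup with cyclic associated permutation group having $q$ orbits of $p$ elements each.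
   Context: A solution (set-theoretic solution of the Pentagon Equation) is a pair $(S,s)$ with $S$ a non-empty set and $s:S\times S\to S\times S$ a map such that $s_{23}s_{13}s_{12}=s_{12}s_{23}$ as maps $S^3\to S^3$, where $s_{12}=s\times \mathrm{id}$, $s_{23}=\mathrm{id}\times s$, $s_{13}=(\tau\times \mathrm{id})(\mathrm{id}\times s)(\tau\times \mathrm{id})$ and $\tau(x,y)=(y,x)$. Writing $s(x,y)=(x\cdot y,\theta_x(y))$, the pair $(S,s)$ is a solution if and only if for all $x,y,z\in S$: $(x\cdot y)\cdot z=x\cdot(y\cdot z)$, $\theta_x(y)\cdot\theta_{x\cdot y}(z)=\theta_x(y\cdot z)$, and $\theta_{\theta_x(y)}\theta_{x\cdot y}=\theta_y$; one says $(S,s)$ is a solution on the semigroup $(S,\cdot)$. It is commutative if $s_{12}s_{13}=s_{13}s_{12}$, equivalently $x\cdot y\cdot z=x\cdot z\cdot y$ and $\theta_{x\cdot y}=\theta_x$ for all $x,y,z\in S$. It is non-degenerate if every $\theta_x:S\to S$ is bijective. A semigroup is left-zero if $x\cdot y=x$ for all $x,y$. For a non-degenerate solution, the associated permutation group $\mathcal{G}(S,s)$ is the subgroup of $\mathrm{Sym}(S)$ generated by $\{\theta_x: x\in S\}$. Two solutions $(S,s)$, $(T,t)$ are isomorphic if there is a bijection $\phi:S\to T$ with $(\phi\times\phi)s=t(\phi\times\phi)$. The solution on a left-zero semigroup with cyclic associated permutation group having $m$ orbits of $n$ elements each is realized as follows: $S=\{x_{i,j}: 1\le i\le m,\ j\in\mathbb{Z}/n\mathbb{Z}\}$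 (so $j\in\{1,\dots,n\}$ read modulo $n$), $\alpha(x_{i,j})=x_{i,j+1}$, $\theta_{x_{i,j}}=\alpha^{2-j}$, and $s(x,y)=(x,\theta_x(y))$. *)

(* Defs.v *)
From HB Require Import structures.
From mathcomp Require Import all_boot all_order all_algebra all_fingroup all_solvable.

Set Implicit Arguments.
Unset Strict Implicit.
Unset Printing Implicit Defensive.

Import GroupScope GRing.Theory.

Section Pentagon.

Variable T : Type.
Implicit Types s : T * T -> T * T.

(* Triples are left-nested: T ^ 3 is (T * T) * T. *)
Definition s12 s (u : T * T * T) : T * T * T := (s u.1, u.2).

Definition s23 s (u : T * T * T) : T * T * T :=
  let: (x, y, z) := u in let: (y', z') := s (y, z) in (x, y', z').

Definition tau12 (u : T * T * T) : T * T * T :=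
  let: (x, y, z) := u in (y, x, z).

Definition s13 s : T * T * T -> T * T * T := tau12 \o s23 s \o tau12.

Definition is_solution s : Prop :=
  inhabited T /\ s23 s \o s13 s \o s12 s =1 s12 s \o s23 s.

Definition commutative_solution s : Prop :=
  s12 s \o s13 s =1 s13 s \o s12 s.

(* s (x, y) = (x . y, theta_x y) *)
Definition dot s (x y : T) : T := (s (x, y)).1.
Definition theta s (x y : T) : T := (s (x, y)).2.

Definition nondegenerate s : Prop := forall x, bijective (theta s x).

Definition on_left_zero s : Prop := forall x y, dot s x y = x.

End Pentagon.

Definition isomorphic (T U : Type) (s : T * T -> T * T) (t : U * U -> U * U) :
    Prop :=
  exists2 phi : T -> U, bijective phi &
    forall x y, (phi (s (x, y)).1, phi (s (x, y)).2) = t (phi x, phi y).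

(* Each theta_x enters as the permutation with the same values; when s is
   non-degenerate there is exactly one such permutation for every x. *)
Definition permutation_group (T : finType) (s : T * T -> T * T) :
    {group {perm T}} :=
  <<[set g : {perm T} | [exists x, [forall y, g y == theta s x y]]]>>%G.

Record finMap := FinMap {
  carrier :> finType;
  smap : carrier * carrier -> carrier * carrier }.

Definition iso (X Y : finMap) : Prop := isomorphic (@smap X) (@smap Y).

Definition comm_nondeg_left_zero (X : finMap) : Prop :=
  [/\ is_solution (@smap X), commutative_solution (@smap X),
      nondegenerate (@smap X) & on_left_zero (@smap X)].

Definition cyclic_with_orbits (m n : nat) (X : finMap) : Prop :=
  let G := permutation_group (@smap X) in
  [/\ cyclic G, #|[set orbit 'P G x | x : X]| = m
    & forall x : X, #|orbit 'P G x| = n].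

Definition complete_list (C : finMap -> Prop) (L : seq finMap) : Prop :=
  [/\ forall i Y, onth L i = Some Y -> C Y,
      forall i j Y Z, onth L i = Some Y -> onth L j = Some Z ->
        i != j -> ~ iso Y Z
    & forall X, C X -> exists i Y, onth L i = Some Y /\ iso X Y].

Definition is_unique_up_to_iso (C : finMap -> Prop) (Y : finMap) : Prop :=
  C Y /\ forall X : finMap, C X -> iso X Y.

Definition trivial_solution (n : nat) : finMap :=
  @FinMap ('Z_n) (fun '(x, y) => (x, y)).

Definition cyclic_solution (n : nat) : finMap :=
  @FinMap ('Z_n) (fun '(x, y) => (x, (- x + y)%R)).

Definition group_solution (gT : finGroupType) : finMap :=
  @FinMap gT (fun '(x, y) => (x, x^-1 * y)).

Definition alpha (m n : nat) (x : 'I_m * 'Z_n) : 'I_m * 'Z_n :=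
  (x.1, (x.2 + 1)%R).

(* theta_(x_(i,j)) = alpha ^ (2 - j), the exponent being the representative
   in {0, ..., n - 1} of 2 - j, which is harmless as alpha ^ n = 1 (1 < n). *)
Definition orbit_solution (m n : nat) : finMap :=
  @FinMap ('I_m * 'Z_n)%type
    (fun '(x, y) => (x, iter (2%:R - x.2 : 'Z_n)%R (@alpha m n) y)).

(* Actions of Z/q on Z/p by group automorphisms; sdprod_by to is then the
   external semidirect product of Z/p by Z/q. *)
Definition Zp_action (p q : nat) : Type :=
  groupAction [set: 'Z_q] [set: 'Z_p].

Definition nonabelian_sdprod (p q : nat) (to : Zp_action p q) : Prop :=
  ~~ abelian [set: sdprod_by to].

(* The action plays no role unless p = 1 mod q. *)
Definition solution_list (p q : nat) (to : Zp_action p q) : seq finMap :=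
  [:: trivial_solution (p * q); cyclic_solution (p * q)]
  ++ (if p - 1 == 0 %[mod q] then [:: group_solution (sdprod_by to)] else [::])
  ++ [:: orbit_solution p q; orbit_solution q p].

(* Main.v *)
Require Import Defs.
From HB Require Import structures.
From mathcomp Require Import all_boot all_order all_algebra all_fingroup all_solvable.
From mathcomp Require Import zify.

Set Implicit Arguments.
Unset Strict Implicit.
Unset Printing Implicit Defensive.

Import GroupScope GRing.Theory.

(** On a left-zero semigroup the axioms of a solution reduce to
    theta_(theta_x y) theta_x = theta_y, and commutativity is automatic.  For
    invertible maps this says Theta (theta_x y) = Theta x ^-1 * Theta y, where
    Theta x is theta_x seen as a permutation.  Hence the image of Theta is
    closed under (g, h) |-> g^-1 * h, so it is the whole permutation group G
    ([permutation_groupE]), and Theta (g x) = g^-1 * Theta x for g in G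
    ([theta_perm_act]).  This equivariance forces G to act freely, and every
    orbit contains exactly one point where Theta is 1, its base point; a point
    x is recovered from its base point e and from Theta x as
    x = Theta x ^-1 e.  So the solution is G x E, with E the set of base
    points, and its isomorphism type amounts to the isomorphism type of G
    together with #|X| ([isog_iso], [iso_isog]).

    When #|X| = pq, the order of the freely acting group G divides pq.  Thus
    G is cyclic of order 1, q, p or pq, or it is nonabelian of order pq.  A
    nonabelian group of order pq is generated by x of order p and y of order q
    with x ^ y = x ^+ k, where k is a primitive q-th root of unity mod p
    ([pq_presentation]); so q divides p - 1, and since any two primitive roots
    are powers of each other such a group is unique up to isomorphism
    ([nonabelian_pq_isog]).  The pair (order of G, is G abelian) is therefore
    a complete invariant of solutions of size pq, and the listed solutions
    realize every possible value exactly once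
    ([solution_list_group_types]). *)

(** * Groups of order pq *)

Lemma card_setZ n : 1 < n -> #|[set: 'Z_n]| = n.
Proof. by move=> n1; rewrite cardsT card_ord Zp_cast. Qed.

Lemma conj_expg_iter (gT : finGroupType) (x y : gT) k i :
  x ^ y = x ^+ k -> x ^ (y ^+ i) = x ^+ (k ^ i).
Proof.
move=> xy; elim: i => [|i IHi]; first by rewrite expg0 conjg1.
by rewrite expgSr conjgM IHi conjXg xy -expgM expnSr mulnC.
Qed.

Lemma natr_Fp_eq p m n : prime p ->
  (m%:R == n%:R :> 'F_p)%R = (m == n %[mod p]).
Proof.
move=> p_pr; apply/eqP/eqP => [/(congr1 val)|mn]; first by rewrite /= !val_Fp_nat.
by apply: val_inj; rewrite /= !val_Fp_nat.
Qed.

Lemma prime_order_root_prim (R : nzRingType) q (z : R) :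
  prime q -> (z ^+ q = 1)%R -> z != 1%R -> (q.-primitive_root z)%R.
Proof.
move=> q_pr zq z1; have [m mz mq] := prim_order_exists (prime_gt0 q_pr) zq.
have /orP[/eqP m1|/eqP <- //] : (m == 1%N) || (m == q).
  by move: q_pr => /primeP[_]; apply.
by move: (prim_expr_order mz) z1; rewrite m1 GRing.expr1 => ->; rewrite eqxx.
Qed.

Section OrderPQ.

Variables p q : nat.
Hypotheses (p_prime : prime p) (q_prime : prime q) (q_lt_p : q < p).

Lemma coprime_pq : coprime p q.
Proof. by rewrite prime_coprime // gtnNdvd // prime_gt0. Qed.

Lemma abelian_pq_cyclic (gT : finGroupType) (G : {group gT}) :
  #|G| = (p * q)%N -> abelian G -> cyclic G.
Proof.
move=> oG abG.
have [|x Gx ox] := Cauchy (G := G) p_prime; first by rewrite oG dvdn_mulr.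
have [|y Gy oy] := Cauchy (G := G) q_prime; first by rewrite oG dvdn_mull.
apply/cyclicP; exists (x * y); apply/eqP; rewrite eq_sym eqEcard cycle_subG groupM //=.
rewrite [#|<[_]>|]orderM ?ox ?oy ?oG ?coprime_pq //.
exact: (centsP abG).
Qed.

(** The number of Sylow p-subgroups is 1 mod p, hence coprime to p, so it
    divides q < p and has to be 1. *)
Lemma sylow_pq_normal (gT : finGroupType) (G : {group gT}) x :
  #|G| = (p * q)%N -> x \in G -> #[x] = p -> <[x]> <| G.
Proof.
move=> oG Gx ox.
have sylP : p.-Sylow(G) <[x]>.
  rewrite pHallE cycle_subG Gx /= -[#|<[x]>|]/#[x] ox oG.
  rewrite partnM ?prime_gt0 // part_pnat_id ?pnat_id //.
  by rewrite part_p'nat ?muln1 // p'natE // gtnNdvd // prime_gt0.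
have n_mod := card_Syl_mod G p_prime.
have := card_Syl_dvd p G; rewrite oG Gauss_dvdr => [/dvdn_leq n_le|].
  have {n_le} n_lt : #|'Syl_p(G)| < p.
    by apply: leq_ltn_trans q_lt_p; apply/n_le/prime_gt0.
  rewrite modn_small // in n_mod.
  rewrite (card_Syl sylP) in n_mod.
  rewrite /normal cycle_subG Gx /=.
  move/eqP: n_mod; rewrite indexg_eq1 => sGN.
  by apply: subset_trans sGN (subsetIr _ _).
by rewrite coprime_sym prime_coprime // /dvdn n_mod.
Qed.

(** Here k^q = 1 mod p because y^q = 1, and k = 1 mod p would make x and y
    commute. *)
Lemma pq_presentation (gT : finGroupType) (G : {group gT}) :
    #|G| = (p * q)%N -> ~~ abelian G ->
  exists x y k, [/\ #[x] = p, #[y] = q, <[x]> ><| <[y]> = G, x ^ y = x ^+ k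
    & (q.-primitive_root (k%:R : 'F_p))%R].
Proof.
move=> oG nabG.
have [|x Gx ox] := Cauchy (G := G) p_prime; first by rewrite oG dvdn_mulr.
have [|y Gy oy] := Cauchy (G := G) q_prime; first by rewrite oG dvdn_mull.
have nxG : <[x]> <| G by apply: sylow_pq_normal.
have nxy : y \in 'N(<[x]>) by apply: (subsetP (normal_norm nxG)).
have tixy : <[x]> :&: <[y]> = 1.
  by rewrite coprime_TIg // -[#|<[x]>|]/#[x] -[#|<[y]>|]/#[y] ox oy coprime_pq.
have defG : <[x]> * <[y]> = G.
  apply/eqP; rewrite eqEcard mul_subG ?cycle_subG //=.
  by rewrite TI_cardMg // -[#|<[x]>|]/#[x] -[#|<[y]>|]/#[y] ox oy oG.
have /cycleP[k xy] : x ^ y \in <[x]> by rewrite memJ_norm ?cycle_id.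
exists x, y, k; split=> //; first by rewrite sdprodE // cycle_subG.
apply: prime_order_root_prim => //.
  apply/eqP; rewrite -natrX (natr_Fp_eq _ 1) // -ox -eq_expg_mod_order.
  by rewrite -(conj_expg_iter q xy) -oy expg_order conjg1 expg1.
apply: contra nabG; rewrite (natr_Fp_eq _ 1) // -ox -eq_expg_mod_order -xy expg1.
move=> /eqP cxy; rewrite -defG abelianM !cycle_abelian /= cent_cycle cycle_subG.
by apply/cent1P/commute_sym/commgP/conjg_fixP.
Qed.

Lemma nonabelian_pq_dvd (gT : finGroupType) (G : {group gT}) :
  #|G| = (p * q)%N -> ~~ abelian G -> p - 1 = 0 %[mod q].
Proof.
move=> oG nabG; have [x [y [k [_ _ _ _ kq]]]] := pq_presentation oG nabG.
apply/eqP; rewrite mod0n -/(dvdn _ _) (prim_order_dvd kq) subn1.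
have k_coprime : coprime k p.
  rewrite coprime_sym prime_coprime //; apply: contraTN kq => p_dvd_k.
  have /eqP -> : (k%:R == 0 :> 'F_p)%R by rewrite (natr_Fp_eq _ 0) // mod0n.
  apply/negP=> /prim_expr_order/eqP.
  by rewrite expr0n gtn_eqF ?prime_gt0 // eq_sym oner_eq0.
rewrite -natrX (natr_Fp_eq _ 1) // -totient_prime //.
exact/eqP/Euler_exp_totient.
Qed.

(** The exponents k and l of two presentations are primitive q-th roots of
    unity in the same field, so k = l^i for some i; replacing the generator v
    by v^i makes the presentations coincide. *)
Lemma nonabelian_pq_isog (gT rT : finGroupType) (G : {group gT}) (H : {group rT}) :
  #|G| = (p * q)%N -> ~~ abelian G -> #|H| = (p * q)%N -> ~~ abelian H ->
  G \isog H.
Proof.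
move=> oG nabG oH nabH.
have [x [y [k [ox oy defG xy kq]]]] := pq_presentation oG nabG.
have [u [v [l [ou ov defH uv lq]]]] := pq_presentation oH nabH.
(* F_p has exactly q roots of X^q - 1, the powers of l. *)
have [i kli] := prim_rootP lq (prim_expr_order kq).
have uvi : u ^ (v ^+ i) = u ^+ k.
  rewrite (conj_expg_iter i uv); apply/eqP.
  by rewrite eq_expg_mod_order ou -natr_Fp_eq // natrX -kli.
have ovi : #[v ^+ i] = q.
  apply: nt_prime_order => //; first by rewrite -expgM mulnC expgM (_ : v ^+ q = 1) ?expg1n // -ov expg_order.
  apply: contraTneq kq => vi1; move: uvi; rewrite vi1 conjg1 => uk.
  have -> : (k%:R = 1 :> 'F_p)%R.
    by apply/eqP; rewrite (natr_Fp_eq _ 1) // -ou -eq_expg_mod_order -uk expg1.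
  apply/negP => /prim_order_dvd/(_ 1%N); rewrite expr1n eqxx dvdn1 => /eqP q1.
  by move: (q_prime); rewrite q1.
have [_ defH' _ tiuv] := sdprodP defH.
have du : #[u] %| #[x] by rewrite ou ox.
have dv : #[v ^+ i] %| #[y] by rewrite ovi oy.
have actf : {in <[x]> & <[y]>, morph_act 'J 'J (eltm du) (eltm dv)}.
  move=> _ _ /cycleP[a ->] /cycleP[b ->] /=.
  rewrite conjXg (conj_expg_iter b xy) -expgM !eltmE conjXg.
  by rewrite (conj_expg_iter b uvi) -expgM.
have inj : 'injm (sdprodm defG actf).
  rewrite injm_sdprodm !injm_eltm ou ox ovi oy !dvdnn /= !im_eltm.
  by rewrite -subG1 -tiuv setIS // cycleX.
apply/isogP; exists (sdprodm_morphism defG actf) => //.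
apply/eqP; rewrite eqEcard.
rewrite card_injm // oG oH leqnn andbT im_sdprodm !im_eltm -defH'.
by rewrite mulgS // cycleX.
Qed.

Lemma card_sdprod_by (to : Zp_action p q) : #|[set: sdprod_by to]| = (p * q)%N.
Proof.
rewrite -(sdprod_card (sdprod_sdpair to)) !card_injm ?injm_sdpair1 ?injm_sdpair2 //.
by rewrite !card_setZ ?prime_gt1.
Qed.

(** A solution z of z^q = 1 mod p with z <> 1 gives a nontrivial action of
    Z/q on Z/p, namely a |-> multiplication by z^a. *)
Section PowerAction.

Variable z : 'Z_p.
Hypotheses (zq : (z ^+ q = 1)%R) (z1 : z != 1%R).

Definition scale_Zp (x : 'Z_p) (a : 'Z_q) : 'Z_p := (x * z ^+ a)%R.

Lemma scale_Zp_is_action : is_action [set: 'Z_q] scale_Zp.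
Proof.
split=> [a x y /(congr1 (fun t => t * z ^+ (q - a))%R)|x a b _ _].
  have aq : a <= q by rewrite ltnW // -[X in _ < X](Zp_cast (prime_gt1 q_prime)).
  by rewrite /scale_Zp -!mulrA -GRing.exprD subnKC // zq !mulr1.
rewrite /scale_Zp -mulrA -GRing.exprD; congr (_ * _)%R.
have -> : val (a * b)%g = ((a + b) %% q)%N.
  exact: (congr1 (modn (a + b)) (Zp_cast (prime_gt1 q_prime))).
by rewrite expr_mod.
Qed.

Definition scale_Zp_action := Action scale_Zp_is_action.

Lemma scale_Zp_is_groupAction : is_groupAction [set: 'Z_p] scale_Zp_action.
Proof.
move=> a _; rewrite inE; apply/andP; split; first by apply/subsetP=> x _; rewrite inE.
by apply/morphicP=> x y _ _; rewrite !actpermE /= /scale_Zp mulrDl.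
Qed.

Definition scale_Zp_groupAction : Zp_action p q := GroupAction scale_Zp_is_groupAction.

Lemma scale_Zp_nonabelian : nonabelian_sdprod scale_Zp_groupAction.
Proof.
apply: contra z1 => /centsP ab.
have := sdpair_act scale_Zp_groupAction (in_setT (1%R : 'Z_p)) (in_setT (1%R : 'Z_q)).
(* In an abelian semidirect product, a = 1 would act trivially on x = 1;
   yet it sends 1 to z. *)
rewrite [RHS](conjg_fixP _); last by apply/commgP/ab; rewrite inE.
move/(injmP (injm_sdpair1 _)); rewrite !inE => /(_ isT isT) /=.
rewrite /scale_Zp mul1r => zE.
by apply/eqP; apply: zE.
Qed.

End PowerAction.

Lemma nonabelian_action_exists :
  p - 1 = 0 %[mod q] -> exists to : Zp_action p q, nonabelian_sdprod to.
Proof.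
move/eqP; rewrite mod0n -/(dvdn _ _) subn1 => q_dvd.
(* The unit group of Z/p has order p - 1, a multiple of q. *)
have [|u _ ou] := Cauchy (G := units_Zp_group p) q_prime.
  by rewrite card_units_Zp ?prime_gt0 // totient_prime.
have uq : (val u ^+ q = 1)%R by rewrite -FinRing.val_unitX -ou expg_order.
have u1 : val u != 1%R.
  apply: contraTneq q_prime => u1; rewrite -ou (_ : u = 1) ?order1 //.
  exact: val_inj.
by exists (scale_Zp_groupAction uq); apply: scale_Zp_nonabelian.
Qed.

End OrderPQ.

(** * The structure of left-zero solutions *)

(** Injectivity is enough since the carrier is finite. *)
Lemma comm_nondeg_left_zeroI (X : finMap) (t : X -> X -> X) (x0 : X) :
    (forall x y, smap (x, y) = (x, t x y)) ->
    (forall x y z, t (t x y) (t x z) = t y z) ->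
    (forall x, injective (t x)) ->
  comm_nondeg_left_zero X.
Proof.
move=> st tM t_inj; split.
- split=> [|[[x y] z]] //; rewrite /s13 /s12 /s23 /tau12 /=.
  by do 4![rewrite ?st /=]; rewrite tM.
- by move=> [[x y] z]; rewrite /s13 /s12 /s23 /tau12 /=; do 2![rewrite ?st /=].
- move=> x; apply: (@injF_bij _ (theta _ x)) => y z.
  by rewrite /theta !st; apply: t_inj.
- by move=> x y; rewrite /dot st.
Qed.

Section LeftZeroSolution.

Variables (X : finMap) (hX : comm_nondeg_left_zero X).

Lemma theta_inj x : injective (theta (@smap X) x).
Proof. by have [_ _ nd _] := hX; apply: bij_inj. Qed.

Definition theta_perm (x : X) : {perm X} := perm (@theta_inj x).

Lemma smapE x y : smap (x, y) = (x, theta_perm x y).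
Proof.
have [_ _ _ /(_ x y)] := hX; rewrite permE /dot /theta.
by case: (smap _) => /= a b ->.
Qed.

(** This is the pentagon equation: products of permutations compose from left
    to right, and theta_(theta_x y) after theta_x is theta_y. *)
Lemma theta_permM x y : theta_perm (theta_perm x y) = (theta_perm x)^-1 * theta_perm y.
Proof.
apply: (mulgI (theta_perm x)); rewrite mulKVg; apply/permP=> z; rewrite permM.
have [[_ pentagon] _ _ _] := hX.
have := pentagon (x, y, z); rewrite /s13 /s12 /s23 /tau12 /=.
by do 4![rewrite ?smapE /=]; case.
Qed.

Let G := permutation_group (@smap X).

Lemma permutation_groupE : G = theta_perm @: X :> {set {perm X}}.
Proof.
have [[[x0] _] _ _ _] := hX.
have th1 : theta_perm (theta_perm x0 x0) = 1 by rewrite theta_permM mulVg.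
have grp : group_set (theta_perm @: X).
  apply/group_setP; split; first by apply/imsetP; exists (theta_perm x0 x0).
  move=> _ _ /imsetP[x _ ->] /imsetP[y _ ->]; apply/imsetP.
  exists (theta_perm (theta_perm x (theta_perm x0 x0)) y) => //.
  by rewrite !theta_permM // mulVg mulg1 invgK.
rewrite /G /permutation_group /= -[RHS](genGid (group grp)); congr <<_>>.
apply/setP=> g; rewrite inE; apply/existsP/imsetP=> [[x /forallP gx]|[x _ ->]].
  by exists x => //; apply/permP=> y; rewrite permE (eqP (gx y)).
by exists x; apply/forallP=> y; rewrite permE.
Qed.

Lemma permutation_groupP g : reflect (exists x, g = theta_perm x) (g \in G).
Proof.
by rewrite permutation_groupE; apply: (iffP imsetP) => [[x _]|[x]]; exists x.
Qed.

Lemma mem_theta_perm x : theta_perm x \in G.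
Proof. by apply/permutation_groupP; exists x. Qed.

Lemma theta_perm_act g x : g \in G -> theta_perm (g x) = g^-1 * theta_perm x.
Proof. by move=> /permutation_groupP[y ->]; apply: theta_permM. Qed.

(** Theta (theta_x x) = Theta x ^-1 * Theta x = 1, so theta_x x is the point
    of the orbit of x at which Theta is trivial. *)
Definition base (x : X) : X := theta_perm x x.
Definition bases : {set X} := [set x | theta_perm x == 1].

Lemma base_in x : base x \in bases.
Proof. by rewrite inE theta_permM mulVg. Qed.

Lemma base_act x y : base (theta_perm x y) = base y.
Proof. by rewrite /base theta_permM -!permM mulKVg. Qed.

Lemma base_inj x y : theta_perm x = theta_perm y -> base x = base y -> x = y.
Proof. by rewrite /base => -> /perm_inj. Qed.

(** x |-> (base x, Theta x) is a bijection onto E x G. *)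
Lemma card_bases : #|X| = (#|bases| * #|G|)%N.
Proof.
pose c x := (base x, theta_perm x).
have c_inj : injective c by move=> x y [/[swap]]; apply: base_inj.
rewrite -cardsX -[LHS]cardsT -(card_imset _ c_inj); congr #|pred_of_set _|.
apply/setP=> -[e g]; rewrite inE /=; apply/imsetP/andP.
  by case=> x _ [-> ->]; rewrite base_in mem_theta_perm.
rewrite inE => -[/eqP e1 Gg]; exists (g^-1 e); first by rewrite inE.
have tg : theta_perm (g^-1 e) = g by rewrite theta_perm_act ?groupV // e1 mulg1 invgK.
by rewrite /c /base tg -permM mulVg perm1.
Qed.

(** The action is free: g x = x gives Theta x = g^-1 * Theta x. *)
Lemma card_orbit_permutation_group x : #|orbit 'P G x| = #|G|.
Proof.
rewrite card_orbit (_ : 'C_G[x | 'P] = 1) ?indexg1 //; apply/trivgP/subsetP=> g.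
rewrite inE => /andP[Gg /astab1P gx].
have := theta_perm_act x Gg; rewrite -[g x]/('P%act x g) gx.
by rewrite -{1}[theta_perm x]mul1g => /mulIg/esym/eqP; rewrite invg_eq1 inE.
Qed.

Lemma card_orbits_permutation_group :
  #|X| = (#|[set orbit 'P G x | x : X]| * #|G|)%N.
Proof.
rewrite -cardsT; apply: card_uniform_partition.
  by move=> _ /imsetP[x _ ->]; apply: card_orbit_permutation_group.
have := @orbit_partition _ _ _ 'P G [set: X].
rewrite (_ : [set _ | x in [set: X]] = [set orbit 'P G x | x : X]); last first.
  by apply/setP=> A; apply/imsetP/imsetP=> -[x _ ->]; exists x; rewrite ?inE.
by apply; apply/actsP=> g _ x; rewrite !inE.
Qed.

Lemma card_orbitsE m n :
  #|G| = n -> #|X| = (m * n)%N -> #|[set orbit 'P G x | x : X]| = m.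
Proof.
move=> <- oX; apply/eqP; rewrite -(eqn_pmul2r (cardG_gt0 G)).
by rewrite -card_orbits_permutation_group oX.
Qed.

(** Any map f to a group that satisfies the same cocycle identity as Theta and
    separates the permutations identifies the permutation group with the image
    of f.  This both computes the group of a concrete solution and, with f
    transported from another solution, shows that the group is an
    invariant. *)
Lemma permutation_group_isog (gT : finGroupType) (H : {group gT}) (f : X -> gT) :
    (forall x y, f (theta_perm x y) = (f x)^-1 * f y) -> 
    (forall x y, f x = f y -> theta_perm x = theta_perm y) ->
    f @: X = H ->
  G \isog H.
Proof.
move=> fM f_inj defH; have [[[x0] _] _ _ _] := hX.
(* The cocycle identity gives f (Theta x x0) = (f x)^-1 * f x0, so this
   sends Theta x to f x without choosing x. *)
pose m (g : {perm X}) := f x0 * (f (g x0))^-1.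
have mE x : m (theta_perm x) = f x by rewrite /m fM invMg invgK mulKVg.
have mM : {in G &, {morph m : g h / g * h}}.
  move=> g h Gg Gh; have /permutation_groupP[w xyw] := groupM Gg Gh.
  move: Gg Gh xyw => /permutation_groupP[x ->] /permutation_groupP[y ->] xyw.
  rewrite xyw !mE; apply: invg_inj; apply: (mulIg (f x0)).
  by rewrite -fM -xyw permM !fM invMg mulgA.
pose mm := Morphism mM.
have mm_inj : 'injm mm.
  apply/injmP=> _ _ /permutation_groupP[x ->] /permutation_groupP[y ->].
  by rewrite /= !mE; apply: f_inj.
apply/isogP; exists mm => //; rewrite -defH morphimEdom /= permutation_groupE.
by rewrite -imset_comp; apply: eq_imset => x; apply: mE.
Qed.

End LeftZeroSolution.

Lemma iso_isog X Y (hX : comm_nondeg_left_zero X) (hY : comm_nondeg_left_zero Y) :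
  iso X Y -> permutation_group (@smap X) \isog permutation_group (@smap Y).
Proof.
case=> phi phi_bij phiE.
have phiM x y : phi (theta_perm hX x y) = theta_perm hY (phi x) (phi y).
  by have := phiE x y; rewrite !smapE /= => -[].
apply: (@permutation_group_isog X hX _ (permutation_group (@smap Y))
  (fun x => theta_perm hY (phi x))).
- by move=> x y; rewrite phiM theta_permM.
- by move=> x y xy; apply/permP=> z; apply: (bij_inj phi_bij); rewrite !phiM xy.
have [psi _ psiK] := phi_bij.
rewrite (permutation_groupE hY); apply/setP=> g.
by apply/imsetP/imsetP=> -[x _ ->]; [exists (phi x) | exists (psi x); rewrite ?psiK].
Qed.

(** Given an isomorphism f of the groups, there are as many base points on
    both sides by [card_bases]; any injection b between them extends to
    g e |-> f g (b e), which in terms of x = Theta x ^-1 (base x) is the map phi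
    below. *)
Lemma isog_iso X Y (hX : comm_nondeg_left_zero X) (hY : comm_nondeg_left_zero Y) :
  #|X| = #|Y| -> permutation_group (@smap X) \isog permutation_group (@smap Y) ->
  iso X Y.
Proof.
move=> eqXY isoG; have /isogP[f f_inj defH] := isoG.
have eqE : #|bases hX| = #|bases hY|.
  apply/eqP; rewrite -(eqn_pmul2r (cardG_gt0 (permutation_group (@smap X)))).
  by rewrite -card_bases eqXY (card_bases hY) (card_isog isoG).
have [[[x0] _] _ _ _] := hX; have [[[y0] _] _ _ _] := hY.
(* The base points are matched by their ranks in the two enumerations. *)
pose b x := nth (base hY y0) (enum (bases hY)) (index x (enum (bases hX))).
have b_lt x : x \in bases hX -> index x (enum (bases hX)) < size (enum (bases hY)).
  by move=> Ex; rewrite -cardE -eqE cardE index_mem mem_enum.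
have b_in x : x \in bases hX -> theta_perm hY (b x) = 1.
  move=> Ex; suff: b x \in bases hY by rewrite inE => /eqP.
  by rewrite -mem_enum mem_nth ?b_lt.
have b_inj : {in bases hX &, injective b}.
  move=> x y Ex Ey /eqP; rewrite nth_uniq ?b_lt ?enum_uniq // => /eqP.
  by apply: (index_inj x0); rewrite mem_enum.
pose phi x : Y := (f (theta_perm hX x))^-1 (b (base hX x)).
have Gf x : f (theta_perm hX x) \in permutation_group (@smap Y).
  by rewrite -defH mem_morphim ?mem_theta_perm.
have phi_th x : theta_perm hY (phi x) = f (theta_perm hX x).
  by rewrite theta_perm_act ?groupV // b_in ?base_in // mulg1 invgK.
have phi_base x : b (base hX x) = f (theta_perm hX x) (phi x).
  by rewrite /phi -permM mulVg perm1.
exists phi; last first.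
  move=> x y; rewrite !smapE /=; congr (_, _).
  rewrite phi_th {1}/phi base_act theta_permM morphM ?morphV ?groupV ?mem_theta_perm //.
  by rewrite invMg invgK permM.
apply: inj_card_bij; last by rewrite eqXY.
move=> x y xy.
have th_eq : theta_perm hX x = theta_perm hX y.
  by apply: (injmP f_inj); rewrite ?mem_theta_perm // -!phi_th xy.
apply: (base_inj th_eq); apply: b_inj; rewrite ?base_in //.
by rewrite !phi_base th_eq xy.
Qed.

(** * The solutions in the list *)

Lemma trivial_solution_left_zero n : comm_nondeg_left_zero (trivial_solution n).
Proof.
apply: (@comm_nondeg_left_zeroI (trivial_solution n) (fun x y => y) (0%R : 'Z_n)) => //.
by move=> _; apply: inj_id.
Qed.

Lemma trivial_solution_group n :
  permutation_group (@smap (trivial_solution n)) = 1 :> {set _}.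
Proof.
have hX := trivial_solution_left_zero n.
apply/trivgP/subsetP=> _ /(permutation_groupP hX)[x ->].
by rewrite inE; apply/eqP/permP=> y; rewrite perm1 permE.
Qed.

Lemma group_solution_left_zero gT : comm_nondeg_left_zero (group_solution gT).
Proof.
apply: (@comm_nondeg_left_zeroI (group_solution gT) (fun x y : gT => x^-1 * y) (1 : gT)).
- by [].
- by move=> x y z; rewrite invMg invgK -mulgA mulKVg.
- by move=> x; apply: mulgI.
Qed.

Lemma group_solution_isog (gT : finGroupType) :
  permutation_group (@smap (group_solution gT)) \isog [set: gT].
Proof.
have hX := group_solution_left_zero gT.
apply: (@permutation_group_isog (group_solution gT) hX gT [set: gT]%G id).
- by move=> x y; rewrite permE.
- by move=> x y ->.
- by apply/setP=> g; rewrite inE; apply/imsetP; exists g.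
Qed.

Lemma iter_alpha m n k (x : 'I_m * 'Z_n) : iter k (@alpha m n) x = (x.1, x.2 + k%:R)%R.
Proof.
elim: k => [|k IHk]; first by rewrite addr0; case: x.
by rewrite iterS IHk /alpha /= -natr1 addrA.
Qed.

Lemma orbit_solutionE m n (x y : 'I_m * 'Z_n) :
  @smap (orbit_solution m n) (x, y) = (x, (y.1, y.2 + (2%:R - x.2))%R).
Proof.
transitivity (x, iter (2%:R - x.2 : 'Z_n)%R (@alpha m n) y) => //.
by rewrite iter_alpha natr_Zp.
Qed.

Lemma orbit_solution_left_zero m n : 0 < m -> comm_nondeg_left_zero (orbit_solution m n).
Proof.
move=> m0; apply: (@comm_nondeg_left_zeroI (orbit_solution m n)
  (fun x y => (y.1, y.2 + (2%:R - x.2))%R) (Ordinal m0, 0%R)).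
- exact: orbit_solutionE.
- move=> x y z /=; congr (_, _).
  by rewrite opprD (addrA 2%:R)%R addrACA subrr addr0.
- move=> x; apply: (can_inj (g := fun y => (y.1, y.2 - (2%:R - x.2))%R)) => -[y1 y2].
  by rewrite addrK.
Qed.

(** Since theta_x translates the second coordinate by 2 - x.2, the
    shift x.2 - 2 is a cocycle with values in Z/n. *)
Lemma orbit_solution_isog m n : 0 < m ->
  permutation_group (@smap (orbit_solution m n)) \isog [set: 'Z_n].
Proof.
move=> m0; have hX := orbit_solution_left_zero n m0.
have thE x y : theta_perm hX x y = (y.1, y.2 + (2%:R - x.2))%R.
  by have := orbit_solutionE x y; rewrite smapE => -[].
apply: (@permutation_group_isog (orbit_solution m n) hX 'Z_n [set: 'Z_n]%G
  (fun x => (x.2 - 2%:R)%R)).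
- move=> x y; rewrite thE.
  have -> : (x.2 - 2%:R)%R^-1 * (y.2 - 2%:R)%R = (2%:R - x.2 + (y.2 - 2%:R))%R :> 'Z_n.
    by rewrite -[in RHS](opprB x.2).
  by rewrite /= -addrA addrCA.
- by move=> x y eq_xy; have xy := addIr _ eq_xy; apply/permP=> z; rewrite !thE xy.
- apply/setP=> g; rewrite inE; apply/imsetP.
  by exists (Ordinal m0, g + 2%:R)%R; rewrite ?addrK.
Qed.

Lemma card_orbit_solution m n : 1 < n -> #|orbit_solution m n| = (m * n)%N.
Proof. by move=> n1; rewrite /= card_prod !card_ord Zp_cast. Qed.

(** As the action is free, orbits of size n mean that the group has order n,
    and m of them mean that X has size m n: the isomorphism type is
    determined. *)
Lemma orbit_solution_unique m n : 0 < m -> 1 < n ->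
  is_unique_up_to_iso
    (fun X => comm_nondeg_left_zero X /\ cyclic_with_orbits m n X)
    (orbit_solution m n).
Proof.
move=> m0 n1; have hY := orbit_solution_left_zero n m0.
have isoY := orbit_solution_isog n m0.
have oZ := card_setZ n1.
have cycZ : cyclic [set: 'Z_n] by apply/cyclicP; exists Zp1; apply: Zp_cycle.
have oG : #|permutation_group (@smap (orbit_solution m n))| = n by rewrite (card_isog isoY).
split.
  split=> //; split.
  - by rewrite (isog_cyclic isoY).
  - by refine (card_orbitsE hY oG (card_orbit_solution m n1)).
  - by move=> x; rewrite card_orbit_permutation_group.
move=> X [hX [cycG m_orbits n_orbit]].
have [[[x0] _] _ _ _] := hX.
have oGX : #|permutation_group (@smap X)| = n.
  by rewrite -(card_orbit_permutation_group hX x0).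
apply: (isog_iso hX hY).
  by rewrite card_orbit_solution // (card_orbits_permutation_group hX) oGX m_orbits.
by rewrite isog_cyclic_card // oG oGX eqxx andbT (isog_cyclic isoY).
Qed.

(** * Classification in size pq *)

Section Classification.

Variables p q : nat.
Hypotheses (p_prime : prime p) (q_prime : prime q) (q_lt_p : q < p).

Let pq1 : 1 < p * q.
Proof. by apply: leq_trans (prime_gt1 p_prime) _; rewrite leq_pmulr ?prime_gt0. Qed.

Variable to : Zp_action p q.
Hypothesis to_nonabelian : p - 1 = 0 %[mod q] -> nonabelian_sdprod to.

Definition group_type (X : finMap) : nat * bool :=
  let G := permutation_group (@smap X) in (#|G|, abelian G).

Lemma group_type_isog X (gT : finGroupType) (H : {group gT}) :
  permutation_group (@smap X) \isog H -> group_type X = (#|H|, abelian H).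
Proof. by move=> isoX; rewrite /group_type (card_isog isoX) (isog_abelian isoX). Qed.

Lemma dvdn_pq_cases d : d %| p * q -> d \in [:: 1; q; p; p * q]%N.
Proof.
have dvd_q e : e %| q -> (e == 1)%N || (e == q).
  by have /primeP[_] := q_prime; apply.
have [p_dvd_d | ] := boolP (p %| d).
  have /dvdnP[e ->] := p_dvd_d; rewrite mulnC dvdn_pmul2l ?prime_gt0 //.
  by move=> /dvd_q/orP[]=> /eqP ->; rewrite ?muln1 !inE eqxx ?orbT.
rewrite -prime_coprime // coprime_sym => cdp; rewrite Gauss_dvdr //.
by move=> /dvd_q/orP[]=> /eqP ->; rewrite !inE eqxx ?orbT.
Qed.

Lemma order_dvd_pq_cyclic (gT : finGroupType) (G : {group gT}) :
  #|G| %| p * q -> cyclic G \/ #|G| = (p * q)%N /\ ~~ abelian G.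
Proof.
move/dvdn_pq_cases; rewrite !inE => /or4P[] /eqP oG.
- by left; move/eqP: oG; rewrite -trivg_card1 => /eqP ->; apply: cyclic1.
- by left; rewrite prime_cyclic ?oG.
- by left; rewrite prime_cyclic ?oG.
- have [abG|] := boolP (abelian G); last by right.
  by left; apply: (abelian_pq_cyclic p_prime q_prime q_lt_p).
Qed.

(** Order and commutativity determine G: it is either cyclic or nonabelian of
    order pq. *)
Lemma same_group_type_iso X Y :
    comm_nondeg_left_zero X -> comm_nondeg_left_zero Y ->
    #|X| = (p * q)%N -> #|Y| = (p * q)%N -> group_type X = group_type Y ->
  iso X Y.
Proof.
move=> hX hY oX oY [eq_ord eq_ab]; apply: (isog_iso hX hY); first by rewrite oX oY.
have dvdX : #|permutation_group (@smap X)| %| p * q.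
  by rewrite -oX (card_bases hX) dvdn_mull.
have [cycX | [ordX nabX]] := order_dvd_pq_cyclic dvdX.
  have [|cycY|[_ /negP[]]] := order_dvd_pq_cyclic (G := permutation_group (@smap Y)).
  - by rewrite -eq_ord.
  - by rewrite isog_cyclic_card // cycY eq_ord eqxx.
  - by rewrite -eq_ab cyclic_abelian.
by apply: (nonabelian_pq_isog p_prime q_prime q_lt_p); rewrite -?eq_ord -?eq_ab.
Qed.

(** The values of [group_type] on solutions of size pq, in the order of
    [solution_list]. *)
Definition group_types : seq (nat * bool) :=
  [:: (1%N, true); ((p * q)%N, true)]
  ++ (if p - 1 == 0 %[mod q] then [:: ((p * q)%N, false)] else [::])
  ++ [:: (q, true); (p, true)].

Lemma uniq_group_types : uniq group_types.
Proof.
have q1 := prime_gt1 q_prime.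
have p_lt : p < p * q by rewrite ltn_Pmulr ?prime_gt0.
rewrite /group_types; move: (p * q)%N p_lt => n p_lt.
by case: ifP => _; rewrite /= !inE !xpair_eqE /=; lia.
Qed.

Lemma mem_group_types X :
    comm_nondeg_left_zero X -> #|X| = (p * q)%N ->
  group_type X \in group_types.
Proof.
move=> hX oX; rewrite /group_type /group_types.
have dvdX : #|permutation_group (@smap X)| %| p * q.
  by rewrite -oX (card_bases hX) dvdn_mull.
have [cycX | [ordX nabX]] := order_dvd_pq_cyclic dvdX.
  rewrite cyclic_abelian // !mem_cat !inE !xpair_eqE !andbT.
  by have := dvdn_pq_cases dvdX; rewrite !inE; case/or4P=> ->; rewrite ?orbT.
rewrite ordX (negPf nabX) (nonabelian_pq_dvd p_prime q_prime q_lt_p ordX nabX).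
by rewrite !mem_cat eqxx !inE eqxx !orbT.
Qed.

Lemma solution_list_group_types : map group_type (solution_list to) = group_types.
Proof.
have oZ n : 1 < n -> #|[set: 'Z_n]| = n by apply: card_setZ.
have abZ n : abelian [set: 'Z_n] by apply: Zp_abelian.
have typeO m n : 0 < m -> 1 < n -> group_type (orbit_solution m n) = (n, true).
  by move=> m0 n1; rewrite (group_type_isog (orbit_solution_isog n m0)) abZ oZ.
have type1 : group_type (trivial_solution (p * q)) = (1, true)%N.
  by rewrite /group_type trivial_solution_group cards1 abelian1.
have typeC : group_type (cyclic_solution (p * q)) = (p * q, true)%N.
  by rewrite (group_type_isog (group_solution_isog 'Z_(p * q))) abZ oZ.
rewrite /solution_list /group_types map_cat map_cat [map _ [:: _; _]]/= type1 typeC.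
rewrite [map _ [:: orbit_solution _ _; _]]/= !typeO ?prime_gt0 ?prime_gt1 //.
case: eqP => //= qp; rewrite (group_type_isog (group_solution_isog _)).
by rewrite card_sdprod_by // (negPf (to_nonabelian qp)).
Qed.

Lemma solution_list_valid i Y : onth (solution_list to) i = Some Y ->
  comm_nondeg_left_zero Y /\ #|Y| = (p * q)%N.
Proof.
have oZ : #|'Z_(p * q)| = (p * q)%N by rewrite card_ord Zp_cast.
have [p0 q0] := (prime_gt0 p_prime, prime_gt0 q_prime).
have [p1 q1] := (prime_gt1 p_prime, prime_gt1 q_prime).
have h1 := trivial_solution_left_zero (p * q).
have hC := group_solution_left_zero 'Z_(p * q).
have hG := group_solution_left_zero (sdprod_by to).
have oG : #|sdprod_by to| = (p * q)%N by rewrite -cardsT card_sdprod_by.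
have hO1 := orbit_solution_left_zero q p0.
have hO2 := orbit_solution_left_zero p q0.
have o1 := card_orbit_solution p q1; have o2 := card_orbit_solution q p1.
rewrite mulnC in o2.
rewrite /solution_list; case: eqP => _.
  by case: i => [|[|[|[|[|i]]]]] /=; rewrite ?onth0n // => -[<-].
by case: i => [|[|[|[|i]]]] /=; rewrite ?onth0n // => -[<-].
Qed.

Lemma solution_list_complete :
  complete_list (fun X => comm_nondeg_left_zero X /\ #|X| = (p * q)%N)
    (solution_list to).
Proof.
split=> [||X [hX oX]]; first exact: solution_list_valid.
  move=> i j Y Z Yi Zj; apply: contra_neq_not => isoYZ.
  have [[hY _] [hZ _]] := (solution_list_valid Yi, solution_list_valid Zj).
  have eqYZ : group_type Y = group_type Z.
    exact: group_type_isog (iso_isog hY hZ isoYZ).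
  have typei : onth group_types i = Some (group_type Y).
    by rewrite -solution_list_group_types onth_map Yi.
  have typej : onth group_types j = Some (group_type Y).
    by rewrite eqYZ -solution_list_group_types onth_map Zj.
  apply: (onth_inj _ _ _ uniq_group_types); last by rewrite typei typej.
  by rewrite gtn_min -!onthTE typei orbT.
have /onthP[i] := mem_group_types hX oX.
rewrite -solution_list_group_types onth_map.
case Yi: (onth _ i) => [Y|] //= /Some_inj eqYX; exists i, Y; split=> //.
have [hY oY] := solution_list_valid Yi.
exact: same_group_type_iso (esym eqYX).
Qed.

End Classification.

Theorem proposition29 (p q : nat) (p_prime : prime p) (q_prime : prime q)
    (q_lt_p : q < p) :
  [/\ p - 1 = 0 %[mod q] ->
        exists to : Zp_action p q, nonabelian_sdprod to,
      forall to to' : Zp_action p q,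
        nonabelian_sdprod to -> nonabelian_sdprod to' ->
        [set: sdprod_by to] \isog [set: sdprod_by to'],
      is_unique_up_to_iso
        (fun X => comm_nondeg_left_zero X /\ cyclic_with_orbits p q X)
        (orbit_solution p q),
      is_unique_up_to_iso
        (fun X => comm_nondeg_left_zero X /\ cyclic_with_orbits q p X)
        (orbit_solution q p)
    & forall to : Zp_action p q,
        (p - 1 = 0 %[mod q] -> nonabelian_sdprod to) ->
        complete_list
          (fun X => comm_nondeg_left_zero X /\ #|X| = (p * q)%N)
          (solution_list to)].
Proof.
split.
- exact: nonabelian_action_exists.
- move=> to to' nab nab'.
  by apply: (nonabelian_pq_isog p_prime q_prime); rewrite ?card_sdprod_by.
- by apply: orbit_solution_unique; rewrite ?prime_gt0 ?prime_gt1.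
- by apply: orbit_solution_unique; rewrite ?prime_gt0 ?prime_gt1.
- by move=> to; apply: solution_list_complete.
Qed.
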